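(* Let $(\mathbf r,\boldsymbol\tau)$, with $\mathbf r=(r_i)_{1\le i\le N}$ and $\boldsymbol\tau=(\tau_{i,j})$, be an optimal transmission scheduler, i.e. an optimal solution of $$\min_{\mathbf r,\boldsymbol\tau}\ \sum_{i=1}^N\frac{B_i}{r_i}f(r_i)\quad\text{subject to}\quad \frac{B_i}{r_i}=\sum_{j\in\mathcal C_i}\tau_{i,j}\ (1\le i\le N),\quad \sum_{i\in\mathcal F_j}\tau_{i,j}\le|\mathcal E_j|\ (1\le j\le M),$$ $$\tau_{i,j}\ge0\ (1\le j\le M,\ i\in\mathcal F_j),\qquad r_i>0\ (1\le i\le N).$$ For each $j\in\{1,\dots,M\}$ let $\Psi_j=\{i\in\mathcal F_j:\tau_{i,j}>0\}$ and $\bar\Psi_j=\{i\in\mathcal F_j:\tau_{i,j}=0\}$. Then for every $j\in\{1,\dots,M\}$: (1) the transmission rates $r_i$, $i\in\Psi_j$, are all equal; (2) $r_i\ge r_k$ for all $i\in\Psi_j$ and all $k\in\bar\Psi_j$.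
   Context: Packets: there are $N$ packets; packet $i$ has size $B_i>0$, arrival instant $t_{a,i}$ and deadline $t_{d,i}>t_{a,i}$, with $0=t_{a,1}<t_{a,2}<\dots<t_{a,N}$; the deadlines are otherwise arbitrary. Let $T=\max_i t_{d,i}$. The life time of packet $i$ is $\mathcal L_i=[t_{a,i},t_{d,i}]$. Epochs: let $0=t_0<t_1<\dots<t_M=T$ be the distinct values among all $t_{a,i},t_{d,i}$, in ascending order. Epoch $j$ is $\mathcal E_j=[t_{j-1},t_j]$, with length $|\mathcal E_j|=t_j-t_{j-1}$. Put $\mathcal C_i=\{j:\mathcal E_j\subseteq\mathcal L_i\}$ and $\mathcal F_j=\{i:\mathcal E_j\subseteq\mathcal L_i\}$. Here $r_i$ is the constant rate at which packet $i$ is transmitted and $\tau_{i,j}$ is the time spent transmitting packet $i$ in epoch $j$ (with $\tau_{i,j}=0$ for $j\notin\mathcal C_i$). Power function: $f:[0,\infty)\to[0,\infty)$ is increasing and strictly convex; transmitting at rate $r$ uses power $f(r)$. *)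

(* Defs.v *)
From mathcomp Require Import all_boot all_order all_algebra.
From mathcomp Require Import boolp classical_sets set_interval reals.

Set Implicit Arguments.
Unset Strict Implicit.
Unset Printing Implicit Defensive.

Import Order.TTheory GRing.Theory Num.Theory.
Local Open Scope ring_scope.

Section PowerFunction.
Variables (R : realType) (f : R -> R).

(* Power functions have domain [0, +oo[; the values of f at negative arguments
   are irrelevant. *)
Definition increasing_on_nneg : Prop :=
  forall x y : R, 0 <= x -> x < y -> f x < f y.

Definition strictly_convex_on_nneg : Prop :=
  forall x y t : R, 0 <= x -> 0 <= y -> x != y -> 0 < t -> t < 1 ->
    f (t * x + (1 - t) * y) < t * f x + (1 - t) * f y.

Definition power_function : Prop :=
  [/\ forall x, 0 <= x -> 0 <= f x, increasing_on_nneg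
    & strictly_convex_on_nneg].

End PowerFunction.

Section Epochs.
Variables (R : realType) (N : nat) (ta td : 'I_N -> R).

Definition instants : seq R :=
  sort <=%R (undup ([seq ta i | i : 'I_N] ++ [seq td i | i : 'I_N])).

Definition nepochs : nat := (size instants).-1.

Definition instant (m : nat) : R := nth 0 instants m.

(* Epochs are numbered from 0: the epoch of index j : 'I_nepochs is
   [t_j, t_(j+1)]. *)
Definition epoch (j : 'I_nepochs) : set R :=
  `[instant j, instant j.+1]%classic.

Definition epoch_length (j : 'I_nepochs) : R := instant j.+1 - instant j.

Definition lifetime (i : 'I_N) : set R := `[ta i, td i]%classic.

Definition epochs_of (i : 'I_N) : {set 'I_nepochs} :=
  [set j | `[< (epoch j `<=` lifetime i)%classic >]].

Definition packets_of (j : 'I_nepochs) : {set 'I_N} :=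
  [set i | `[< (epoch j `<=` lifetime i)%classic >]].

Definition horizon : R := \big[Num.max/0]_(i < N) td i.

Lemma instants_sorted : sorted <%R instants.
Proof. by rewrite sort_lt_sorted undup_uniq. Qed.

Lemma mem_instants x :
  (x \in instants) = [exists i, (x == ta i) || (x == td i)].
Proof.
rewrite mem_sort mem_undup mem_cat; apply/orP/existsP.
  by case=> /mapP[i _ ->]; exists i; rewrite eqxx ?orbT.
by case=> i /orP[] /eqP->; [left|right]; apply: map_f; rewrite mem_enum.
Qed.

Lemma instantP (j : 'I_nepochs) : instant j < instant j.+1.
Proof.
have jM : (j.+1 < size instants)%N.
  by have := ltn_ord j; rewrite {2}/nepochs; case: (size instants).
by rewrite /instant (lt_sorted_ltn_nth _ instants_sorted) ?inE // ltnW.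
Qed.

(* The first and last instants are 0 and T = max_i td i; the default 0 in
   horizon is harmless because deadlines are positive. *)
Lemma horizonP (hN : (0 < N)%N) :
    ta (Ordinal hN) = 0 -> (forall i k : 'I_N, (i < k)%N -> ta i < ta k) ->
    (forall i, ta i < td i) ->
  instant 0 = 0 /\ instant nepochs = horizon.
Proof.
move=> ta0 tamono tad.
have ta_ge0 i : 0 <= ta i.
  have [i0|] := posnP i; last by move=> /(tamono (Ordinal hN)); rewrite ta0 => /ltW.
  by rewrite (_ : i = Ordinal hN) ?ta0 //; apply: val_inj.
have td_ge0 i : 0 <= td i by rewrite (le_trans (ta_ge0 i)) ?ltW.
have mem0 : 0 \in instants.
  by rewrite mem_instants; apply/existsP; exists (Ordinal hN); rewrite ta0 eqxx.
have sz : (0 < size instants)%N by case: instants mem0.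
have leh i : td i <= horizon by rewrite /horizon (bigD1 i) //= le_max lexx.
have memh : horizon \in instants.
  rewrite /horizon; elim/big_ind: _ => //.
    by move=> x y hx hy; rewrite /Num.max; case: ifP.
  by move=> i _; rewrite mem_instants; apply/existsP; exists i; rewrite eqxx orbT.
have leN x : x \in instants -> 0 <= x <= horizon.
  rewrite mem_instants => /existsP[i /orP[] /eqP->].
    by rewrite ta_ge0 (le_trans _ (leh i)) ?ltW.
  by rewrite td_ge0 leh.
have srt : sorted <=%R instants by exact: sort_le_sorted.
have lst : (nepochs < size instants)%N by rewrite /nepochs prednK.
split; apply/eqP; rewrite eq_le.
  have /andP[-> _] := leN _ (mem_nth 0 sz); rewrite andbT.
  rewrite -[leRHS](nth_index 0 mem0) /instant.
  by rewrite (le_sorted_leq_nth _ srt) ?inE ?index_mem.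
have /andP[_ ->] /= := leN _ (mem_nth 0 lst).
rewrite -[leLHS](nth_index 0 memh) (le_sorted_leq_nth _ srt) ?inE ?index_mem //.
by rewrite /nepochs -ltnS prednK // index_mem.
Qed.

End Epochs.

Section Scheduler.
Variables (R : realType) (N : nat) (B ta td : 'I_N -> R) (f : R -> R).

Local Notation M := (nepochs ta td).

(* tau is indexed by all pairs (i, j), so it is required to vanish on the pairs
   for which epoch j is not contained in the life time of packet i. *)
Definition feasible (r : 'I_N -> R) (tau : 'I_N -> 'I_M -> R) : Prop :=
  [/\ forall i, B i / r i = \sum_(j in epochs_of ta td i) tau i j,
      forall j, \sum_(i in packets_of j) tau i j <= epoch_length j,
      forall j i, i \in packets_of j -> 0 <= tau i j,
      forall i j, j \notin epochs_of ta td i -> tau i j = 0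
    & forall i, 0 < r i].

Definition energy (r : 'I_N -> R) : R := \sum_(i < N) B i / r i * f (r i).

Definition optimal_scheduler (r : 'I_N -> R) (tau : 'I_N -> 'I_M -> R) : Prop :=
  feasible r tau /\
  forall r' tau', feasible r' tau' -> energy r <= energy r'.

Definition active (tau : 'I_N -> 'I_M -> R) (j : 'I_M) : {set 'I_N} :=
  [set i in packets_of j | 0 < tau i j].

Definition inactive (tau : 'I_N -> 'I_M -> R) (j : 'I_M) : {set 'I_N} :=
  [set i in packets_of j | tau i j == 0].

End Scheduler.

(* Main.v *)
(* If packet i is active in an epoch where packet k may also be sent, and
   r i < r k, then moving a little time d from i to k in that epoch makes both
   rates move strictly inside ]r i, r k[.  The total transmission time and the
   total amount of data of the two packets are unchanged, so by strict convexity
   their total energy strictly decreases. *)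
Require Import Defs.
From mathcomp Require Import all_boot all_order all_algebra.
From mathcomp Require Import boolp classical_sets set_interval reals.
From mathcomp Require Import ring lra.

Set Implicit Arguments.
Unset Strict Implicit.
Unset Printing Implicit Defensive.

Import Order.TTheory GRing.Theory Num.Theory.
Local Open Scope ring_scope.

Section StrictConvexity.
Variables (R : realType) (f : R -> R).
Hypothesis f_convex : strictly_convex_on_nneg f.

(** Strict convexity with the weight [(y - z) / (y - x)], which makes [z] the convex combination of
    [x] and [y]; the denominator [y - x] is cleared. *)
Lemma strictly_convex_chord x y z : 0 <= x -> x < z -> z < y ->
  (y - x) * f z < (y - z) * f x + (z - x) * f y.
Proof.
move=> x0 xz zy; have xy := lt_trans xz zy.
have d0 : 0 < y - x by rewrite subr_gt0.
have t0 : 0 < (y - z) / (y - x) by rewrite divr_gt0 // subr_gt0.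
have t1 : (y - z) / (y - x) < 1 by rewrite ltr_pdivrMr // mul1r; lra.
have y0 : 0 <= y by rewrite (le_trans x0) // ltW.
have := f_convex x0 y0 (negbT (lt_eqF xy)) t0 t1.
have dn0 : y - x != 0 by rewrite gt_eqF.
have -> : (y - z) / (y - x) * x + (1 - (y - z) / (y - x)) * y = z by field.
rewrite -(ltr_pM2l d0).
by congr (_ < _); field.
Qed.

(* The two sides integrate f against measures with the same mass and the same
   barycenter, the one on the right being carried by the endpoints x and y. *)
Lemma strictly_convex_spread x y p q a b u v :
  0 <= x -> x < p < y -> x < q < y -> 0 < a -> 0 < b ->
  a + b = u + v -> a * p + b * q = u * x + v * y ->
  a * f p + b * f q < u * f x + v * f y.
Proof.
move=> x0 /andP[xp py] /andP[xq qy] a0 b0 mass bary.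
have d0 : 0 < y - x by rewrite subr_gt0 (lt_trans xp).
have := strictly_convex_chord x0 xp py; rewrite -(ltr_pM2l a0) => hp.
have := strictly_convex_chord x0 xq qy; rewrite -(ltr_pM2l b0) => hq.
rewrite -(ltr_pM2l d0).
have -> : (y - x) * (a * f p + b * f q) =
    a * ((y - x) * f p) + b * ((y - x) * f q) by ring.
(* The summed chord bounds equal the target exactly: chords are affine, so only the mass [a + b] and
   the moment [a * p + b * q] enter. *)
rewrite (lt_le_trans (ltrD hp hq)) // le_eqVlt; apply/orP; left; apply/eqP.
transitivity (((a + b) * y - (a * p + b * q)) * f x +
  ((a * p + b * q) - (a + b) * x) * f y); first by ring.
by rewrite mass bary; ring.
Qed.

End StrictConvexity.

Section Exchange.
Variables (R : realType) (N : nat) (B ta td : 'I_N -> R) (f : R -> R).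
Hypothesis B_gt0 : forall i, 0 < B i.
Variables (r : 'I_N -> R) (tau : 'I_N -> 'I_(nepochs ta td) -> R).
Variables (j : 'I_(nepochs ta td)) (i k : 'I_N) (d : R).
Hypotheses (i_j : i \in packets_of j) (k_j : k \in packets_of j) (ki : k != i).

Definition time_shift (m : 'I_N) : R := ((m == k)%:R - (m == i)%:R) * d.

Definition shifted_tau (m : 'I_N) (e : 'I_(nepochs ta td)) : R :=
  tau m e + if e == j then time_shift m else 0.

(** The new rate is forced: the same data [B m] must fit the total time of [m] after the shift. *)
Definition shifted_rate (m : 'I_N) : R := B m / (B m / r m + time_shift m).

Lemma time_shift_from : time_shift i = - d.
Proof. by rewrite /time_shift eqxx eq_sym (negbTE ki) sub0r mulN1r. Qed.

Lemma time_shift_to : time_shift k = d.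
Proof. by rewrite /time_shift eqxx (negbTE ki) subr0 mul1r. Qed.

Lemma time_shift_other m : m != i -> m != k -> time_shift m = 0.
Proof. by move=> /negbTE mi /negbTE mk; rewrite /time_shift mi mk subrr mul0r. Qed.

Lemma time_shift_notin m : m \notin packets_of j -> time_shift m = 0.
Proof. by move=> mj; apply: time_shift_other; apply: contraNneq mj => ->. Qed.

(** The bound [d <= tau i j] keeps the time of [i] in epoch [j] nonnegative, and [d < B i / r i]
    keeps its total time, hence its new rate, positive. *)
Lemma shifted_feasible :
    feasible B r tau -> 0 <= d -> d <= tau i j -> d < B i / r i ->
  feasible B shifted_rate shifted_tau.
Proof.
move=> [rtau cap tau_ge0 tau0 r_gt0] d_ge0 d_tau d_lt.
have w_gt0 m : 0 < B m / r m + time_shift m.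
  have [->|mi] := eqVneq m i; first by rewrite time_shift_from subr_gt0.
  have wm : 0 < B m / r m by rewrite divr_gt0.
  have [->|mk] := eqVneq m k; last by rewrite time_shift_other // addr0.
  by rewrite time_shift_to ltr_wpDr // divr_gt0.
have epochsE m : (j \in epochs_of ta td m) = (m \in packets_of j).
  by rewrite !inE.
split=> [m|e|e m me|m e me|m].
- rewrite /shifted_rate invfM invrK mulVKf ?gt_eqF //.
  rewrite big_split /= -rtau; congr (_ + _).
  (* Only the term [e = j] can contribute; if epoch [j] is outside the life time of [m], then [m] is
     neither [i] nor [k] and its shift is 0. *)
  rewrite -big_mkcondr /=.
  have [mj|mj] := boolP (m \in packets_of j).
    rewrite (big_pred1 j) // => e /=.
    by case: (eqVneq e j) => [->|_]; rewrite ?epochsE ?mj ?andbF.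
  by rewrite time_shift_notin // big1.
- rewrite big_split /=; case: eqVneq => [->|_]; last by rewrite big1_eq addr0 cap.
  (* The shifts [- d] of [i] and [d] of [k] cancel, so the load of epoch [j] is unchanged. *)
  rewrite [X in _ + X](bigD1 i) //= [X in _ + (_ + X)](bigD1 k) ?k_j //=.
  rewrite time_shift_from time_shift_to [X in _ + (_ + (_ + X))]big1.
    by rewrite addr0 addNr addr0 cap.
  move=> m /andP[/andP[_ mi] mk].
  exact: time_shift_other.
- rewrite /shifted_tau; case: eqVneq me => [->|_] me; last by rewrite addr0 tau_ge0.
  have [->|mi] := eqVneq m i; first by rewrite time_shift_from subr_ge0.
  have [->|mk] := eqVneq m k; first by rewrite time_shift_to addr_ge0 ?tau_ge0.
  by rewrite time_shift_other // addr0 tau_ge0.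
- rewrite /shifted_tau tau0 // add0r; case: eqVneq me => // ->.
  by rewrite epochsE; exact: time_shift_notin.
- by rewrite /shifted_rate divr_gt0.
Qed.

(** The two upper bounds on [d] say that the new rate of [i] stays below [r k] and that of [k] above
    [r i]; the other two bounds on the new rates follow from [0 < d]. *)
Lemma shifted_energy_lt :
    strictly_convex_on_nneg f -> (forall m, 0 < r m) -> r i < r k ->
    0 < d -> d < B i / r i - B i / r k -> d < B k / r i - B k / r k ->
  energy B f shifted_rate < energy B f r.
Proof.
move=> f_convex r_gt0 rik d_gt0 di dk.
have B_neq0 m : B m != 0 by rewrite gt_eqF.
have r_neq0 m : r m != 0 by rewrite gt_eqF.
have timeE m : B m / shifted_rate m = B m / r m + time_shift m.
  by rewrite /shifted_rate invfM invrK mulVKf.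
have wik : 0 < B i / r k by rewrite divr_gt0.
have wkk : 0 < B k / r k by rewrite divr_gt0.
have wi_gt0 : 0 < B i / r i - d by lra.
have wk_gt0 : 0 < B k / r k + d by lra.
have rateP m x : 0 < x -> (B m / x < r k) = (B m / r k < x).
  by move=> x_gt0; rewrite ltr_pdivrMr // ltr_pdivrMr // mulrC.
have ratePi m x : 0 < x -> (r i < B m / x) = (x < B m / r i).
  by move=> x_gt0; rewrite ltr_pdivlMr // ltr_pdivlMr // mulrC.
rewrite /energy (bigD1 i) //= (bigD1 k) //= [ltRHS](bigD1 i) //=.
rewrite [X in _ < _ + X](bigD1 k) //= !addrA.
set rest := \sum_(m < N | _) _; set rest' := \sum_(m < N | _) _.
have -> : rest = rest'.
  apply: eq_bigr => m /andP[mi mk].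
  by rewrite timeE /shifted_rate time_shift_other // addr0 invfM invrK mulVKf.
rewrite ltrD2r !timeE time_shift_from time_shift_to.
rewrite /shifted_rate time_shift_from time_shift_to.
(* Transmission times are the masses and rates the points: equal mass is equal total time, and both
   moments are [B i + B k]. *)
apply: strictly_convex_spread => //.
- exact: ltW.
- by rewrite rateP // ratePi //; apply/andP; split; lra.
- by rewrite rateP // ratePi //; apply/andP; split; lra.
- by ring.
- have wi_neq0 : B i / r i - d != 0 by rewrite gt_eqF.
  have wk_neq0 : B k / r k + d != 0 by rewrite gt_eqF.
  by rewrite [(B i / r i - d) * _]mulrC [(B k / r k + d) * _]mulrC !divfK.
Qed.

End Exchange.

(** Packet [k] need only be allowed in epoch [j], so both claims of the theorem follow from this one
    comparison. *)
Lemma rate_active_ge (R : realType) (N : nat) (B ta td : 'I_N -> R) (f : R -> R)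
    (r : 'I_N -> R) (tau : 'I_N -> 'I_(nepochs ta td) -> R) j i k :
    (forall m, 0 < B m) -> strictly_convex_on_nneg f ->
    optimal_scheduler B f r tau ->
    i \in active tau j -> k \in packets_of j ->
  r k <= r i.
Proof.
move=> B_gt0 f_convex [feas opt]; rewrite inE => /andP[i_j tau_gt0] k_j.
have [_ _ _ _ r_gt0] := feas.
rewrite leNgt; apply/negP => rik.
have ki : k != i by apply: contraTneq rik => ->; rewrite ltxx.
have gap m : 0 < B m / r i - B m / r k.
  by rewrite subr_gt0 ltr_pM2l // ltf_pV2 ?posrE.
(* [c] collects the upper limits on the shifted time; halving it makes them all strict. *)
pose c := Num.min (tau i j) (Num.min (B i / r i - B i / r k)
                                     (B k / r i - B k / r k)).
have c_gt0 : 0 < c by rewrite !lt_min tau_gt0 !gap.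
have d_gt0 : 0 < c / 2 by rewrite divr_gt0.
have : c / 2 < c by rewrite ltr_pdivrMr // mulr_natr mulr2n ltrDl.
rewrite {2}/c !lt_min => /and3P[d_tau di dk].
have d_wi : c / 2 < B i / r i.
  by rewrite (lt_trans di) // ltrBlDr ltrDl divr_gt0.
have := shifted_energy_lt B_gt0 ki f_convex r_gt0 rik d_gt0 di dk.
rewrite ltNge => /negP[]; apply: opt.
by apply: (shifted_feasible B_gt0 i_j k_j ki feas); rewrite // ltW.
Qed.

Theorem lemma3 (R : realType) (N : nat) (hN : (0 < N)%N)
    (B ta td : 'I_N -> R) (f : R -> R)
    (hB : forall i, 0 < B i)
    (hta0 : ta (Ordinal hN) = 0)
    (hta : forall i k : 'I_N, (i < k)%N -> ta i < ta k)
    (htd : forall i, ta i < td i)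
    (hf : power_function f)
    (r : 'I_N -> R) (tau : 'I_N -> 'I_(nepochs ta td) -> R)
    (hopt : optimal_scheduler B f r tau) :
  forall j : 'I_(nepochs ta td),
    (forall i k, i \in active tau j -> k \in active tau j -> r i = r k) /\
    (forall i k, i \in active tau j -> k \in inactive tau j -> r k <= r i).
Proof.
have [_ _ f_convex] := hf.
have rate_ge := rate_active_ge hB f_convex hopt.
move=> j; split=> i k ij kj.
  have sub m : m \in active tau j -> m \in packets_of j.
    by rewrite inE => /andP[].
  (* Two active packets can exchange roles, so equality follows by antisymmetry. *)
  by apply/eqP; rewrite eq_le (rate_ge j k i) ?(rate_ge j i k) ?sub.
by apply: (rate_ge j i k ij); move: kj; rewrite inE => /andP[].
Qed.
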